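(* We have $Z^\star_{\rm CVaR}(\boldsymbol{w}^\star)=Z^\star_{\rm JCC}(\mathbf{e})$ for $\boldsymbol{w}^\star\in\Delta^M_{++}$ defined through $$w^\star_m=\frac{\|\boldsymbol{b}_m\|_*^{-1}}{\sum_{\ell\in[M]}\|\boldsymbol{b}_\ell\|_*^{-1}}\qquad\forall m\in[M].$$
   Context: Data: a compact polyhedron $\mathcal{X} \subseteq \mathbb{R}^L$; a cost vector $\boldsymbol{c}\in\mathbb{R}^L$; for $m\in[M]$, vectors $\boldsymbol{a}_m\in\mathbb{R}^L$, $\boldsymbol{b}_m\in\mathbb{R}^K$ with $\boldsymbol{b}_m\neq\boldsymbol{0}$, and scalars $b_{m0}\in\mathbb{R}$; samples $\hat{\boldsymbol{\xi}}_1,\dots,\hat{\boldsymbol{\xi}}_N \in \mathbb{R}^K$; a risk threshold $\varepsilon \in (0,1)$; a radius $\theta \ge 0$; a norm $\|\cdot\|$ on $\mathbb{R}^K$ with dual norm $\|\cdot\|_*$. Write $[N]=\{1,\dots,N\}$, $\mathbf{e}$ for the all-ones vector, $(y)^+=\max\{y,0\}$, and $\Delta^M_{++}=\{\boldsymbol{w}\in(0,1)^M : \mathbf{e}^\top\boldsymbol{w}=1\}$. Wasserstein ball: $\mathcal{F}(\theta) = \{\mathbb{P}\in\mathcal{P}(\mathbb{R}^K) : d_{\rm W}(\mathbb{P},\hat{\mathbb{P}})\le\theta\}$, where $\mathcal{P}(\mathbb{R}^K)$ is the set of probability distributions on $\mathbb{R}^K$, $\hat{\mathbb{P}}=\frac1N\sum_{i=1}^N\delta_{\hat{\boldsymbol{\xi}}_i}$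 and $d_{\rm W}(\mathbb{P}_1,\mathbb{P}_2)=\inf \mathbb{E}[\|\tilde{\boldsymbol{\xi}}_1-\tilde{\boldsymbol{\xi}}_2\|]$, the infimum being over all joint distributions of $(\tilde{\boldsymbol{\xi}}_1,\tilde{\boldsymbol{\xi}}_2)$ with marginals $\mathbb{P}_1,\mathbb{P}_2$. CVaR: $\mathbb{P}\text{-CVaR}_\varepsilon(\ell(\tilde{\boldsymbol{\xi}}))=\inf\{\tau+\mathbb{E}_{\mathbb{P}}[(\ell(\tilde{\boldsymbol{\xi}})-\tau)^+]/\varepsilon : \tau\in\mathbb{R}\}$. For $\boldsymbol{w}\in\Delta^M_{++}$, the worst-case CVaR constrained program is $$Z^\star_{\rm CVaR}(\boldsymbol{w})=\min_{\boldsymbol{x}\in\mathcal{X}}\Big\{\boldsymbol{c}^\top\boldsymbol{x} \;:\; \sup_{\mathbb{P}\in\mathcal{F}(\theta)}\mathbb{P}\text{-CVaR}_\varepsilon\Big(\max_{m\in[M]}\{w_m(\boldsymbol{a}_m^\top\boldsymbol{x}-\boldsymbol{b}_m^\top\tilde{\boldsymbol{\xi}}-b_{m0})\}\Big)\le 0\Big\}.$$ For $\boldsymbol{\kappa}\in[0,1]^N$ define $$\mathcal{C}_{\rm JCC}(\boldsymbol{\kappa})=\left\{(\boldsymbol{x},\boldsymbol{s},t)\in\mathcal{X}\times\mathbb{R}^N_+\times\mathbb{R} \;:\; \varepsilon N t-\mathbf{e}^\top\boldsymbol{s}\ge\theta N,\; \kappa_i\,\frac{\boldsymbol{b}_m^\top\hat{\boldsymbol{\xi}}_i+b_{m0}-\boldsymbol{a}_m^\top\boldsymbol{x}}{\|\boldsymbol{b}_m\|_*}\ge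 t-s_i\;\forall m\in[M],\,i\in[N]\right\}$$ and $Z^\star_{\rm JCC}(\boldsymbol{\kappa})=\min\{\boldsymbol{c}^\top\boldsymbol{x} : (\boldsymbol{x},\boldsymbol{s},t)\in\mathcal{C}_{\rm JCC}(\boldsymbol{\kappa})\}$. The optimal value of an infeasible minimization problem is $+\infty$. *)

(* Defs.v *)
From HB Require Import structures.
From mathcomp Require Import all_boot all_order all_algebra.
From mathcomp Require Import all_classical all_reals all_analysis.

Set Implicit Arguments.
Unset Strict Implicit.
Unset Printing Implicit Defensive.

Import Order.TTheory GRing.Theory Num.Theory.
Import numFieldNormedType.Exports.

Local Open Scope classical_set_scope.
Local Open Scope ring_scope.

Definition dot (R : realType) (n : nat) (u v : 'rV[R]_n) : R :=
  \sum_(i < n) u ord0 i * v ord0 i.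

(* 'rV[R]_n also carries the library's sup norm; an arbitrary norm on R^n is
   therefore given as a function subject to the norm axioms. *)
Record is_norm (R : realType) (n : nat) (nrm : 'rV[R]_n -> R) : Prop := IsNorm {
  is_norm_triangle : forall u v, nrm (u + v) <= nrm u + nrm v ;
  is_norm_homog : forall (a : R) u, nrm (a *: u) = `|a| * nrm u ;
  is_norm_definite : forall u, nrm u = 0 -> u = 0 }.

Definition dual_norm (R : realType) (n : nat) (nrm : 'rV[R]_n -> R)
    (b : 'rV[R]_n) : R :=
  sup [set dot b u | u in [set u | nrm u <= 1]].

Definition is_polyhedron (R : realType) (n : nat) (X : set 'rV[R]_n) : Prop :=
  exists (p : nat) (g : 'I_p -> 'rV[R]_n) (h : 'I_p -> R),
    X = [set x | forall j, dot (g j) x <= h j].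

(* The seed f ord0 is one of the values, so this is the maximum of f, whatever
   the signs. *)
Definition fmax (R : realType) (M : nat) (f : 'I_M.+1 -> R) : R :=
  \big[Num.max/f ord0]_(m < M.+1) f m.

Definition borel_rV (R : realType) (n : nat) :=
  g_sigma_algebraType (@open 'rV[R]_n).

Definition empirical (R : realType) (K N : nat) (xi : 'I_N.+1 -> 'rV[R]_K)
    (A : set (borel_rV R K)) : \bar R :=
  ((N.+1%:R^-1)%:E * \sum_(i < N.+1) dirac (xi i : borel_rV R K) A)%E.

Section empirical_probability.
Context (R : realType) (K N : nat) (xi : 'I_N.+1 -> 'rV[R]_K).

Let empiricalE : empirical xi = mscale (N.+1%:R^-1)%:nng
  (msum (fun i : nat => dirac (xi (inord i) : borel_rV R K)) N.+1).
Proof.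
apply/funext => A; rewrite /empirical /mscale /msum/=; congr (_ * _)%E.
by apply: eq_bigr => i _; rewrite inord_val.
Qed.

Let empirical0 : empirical xi set0 = 0%E.
Proof. by rewrite empiricalE measure0. Qed.

Let empirical_ge0 A : (0 <= empirical xi A)%E.
Proof. by rewrite empiricalE measure_ge0. Qed.

Let empirical_sigma_additive : semi_sigma_additive (empirical xi).
Proof. by rewrite empiricalE; exact: measure_semi_sigma_additive. Qed.

HB.instance Definition _ := isMeasure.Build _ _ _ (empirical xi)
  empirical0 empirical_ge0 empirical_sigma_additive.

Let empirical_setT : empirical xi setT = 1%E.
Proof.
rewrite /empirical; under eq_bigr do rewrite diracT.
rewrite sumEFin -EFinM; congr EFin.
by rewrite sumr_const card_ord mulVf// pnatr_eq0.
Qed.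

HB.instance Definition _ := Measure_isProbability.Build _ _ _ (empirical xi)
  empirical_setT.

End empirical_probability.

Definition coupling (R : realType) (K : nat)
    (P1 P2 : probability (borel_rV R K) R) :
    set (probability (borel_rV R K * borel_rV R K)%type R) :=
  [set Q | forall A, measurable A ->
     pushforward Q fst A = P1 A /\ pushforward Q snd A = P2 A].

Definition wasserstein (R : realType) (K : nat) (nrm : 'rV[R]_K -> R)
    (P1 P2 : probability (borel_rV R K) R) : \bar R :=
  ereal_inf [set ('E_Q[fun z => nrm ((z.1 : 'rV[R]_K) - (z.2 : 'rV[R]_K))%R])%E
            | Q in coupling P1 P2].

Definition wasserstein_ball (R : realType) (K N : nat) (nrm : 'rV[R]_K -> R)
    (xi : 'I_N.+1 -> 'rV[R]_K) (theta : R) :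
    set (probability (borel_rV R K) R) :=
  [set P | (wasserstein nrm P (empirical xi) <= theta%:E)%E].

Definition CVaR (R : realType) (K : nat) (P : probability (borel_rV R K) R)
    (eps : R) (l : 'rV[R]_K -> R) : \bar R :=
  ereal_inf [set (tau%:E
                  + 'E_P[fun y => Num.max (l y - tau)%R 0%R] * (eps^-1)%:E)%E
            | tau in [set: R]].

(* (0,1)^M with unit coordinate sum; it is empty for M = 1. *)
Definition open_simplex (R : realType) (M : nat) : set ('I_M -> R) :=
  [set w | (forall m, 0 < w m < 1) /\ \sum_(m < M) w m = 1].

Definition loss (R : realType) (L K M : nat) (a : 'I_M.+1 -> 'rV[R]_L)
    (b : 'I_M.+1 -> 'rV[R]_K) (b0 w : 'I_M.+1 -> R)
    (x : 'rV[R]_L) (y : 'rV[R]_K) : R :=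
  fmax (fun m => w m * (dot (a m) x - dot (b m) y - b0 m)).

(* Optimal values are extended-real infima, so that an infeasible problem has
   value +oo. *)
Definition Z_CVaR (R : realType) (L K M N : nat) (X : set 'rV[R]_L)
    (c : 'rV[R]_L) (a : 'I_M.+1 -> 'rV[R]_L) (b : 'I_M.+1 -> 'rV[R]_K)
    (b0 : 'I_M.+1 -> R) (xi : 'I_N.+1 -> 'rV[R]_K) (eps theta : R)
    (nrm : 'rV[R]_K -> R) (w : 'I_M.+1 -> R) : \bar R :=
  ereal_inf [set (dot c x)%:E | x in [set x | X x /\
    (ereal_sup
      [set CVaR P eps (loss a b b0 w x)
      | P in wasserstein_ball nrm xi theta] <= 0)%E]].

Definition C_JCC (R : realType) (L K M N : nat) (X : set 'rV[R]_L)
    (a : 'I_M.+1 -> 'rV[R]_L) (b : 'I_M.+1 -> 'rV[R]_K)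
    (b0 : 'I_M.+1 -> R) (xi : 'I_N.+1 -> 'rV[R]_K) (eps theta : R)
    (nrm : 'rV[R]_K -> R) (kappa : 'I_N.+1 -> R) :
    set ('rV[R]_L * 'rV[R]_N.+1 * R) :=
  [set z : 'rV[R]_L * 'rV[R]_N.+1 * R | let: (x, s, t) := z in
    [/\ X x, forall i, 0 <= s ord0 i,
        theta * N.+1%:R <= eps * N.+1%:R * t - \sum_(i < N.+1) s ord0 i
      & forall m i, t - s ord0 i <=
          kappa i * ((dot (b m) (xi i) + b0 m - dot (a m) x)
                     / dual_norm nrm (b m))]].

Definition Z_JCC (R : realType) (L K M N : nat) (X : set 'rV[R]_L)
    (c : 'rV[R]_L) (a : 'I_M.+1 -> 'rV[R]_L) (b : 'I_M.+1 -> 'rV[R]_K)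
    (b0 : 'I_M.+1 -> R) (xi : 'I_N.+1 -> 'rV[R]_K) (eps theta : R)
    (nrm : 'rV[R]_K -> R) (kappa : 'I_N.+1 -> R) : \bar R :=
  ereal_inf [set (dot c z.1.1)%:E
            | z in C_JCC X a b b0 xi eps theta nrm kappa].

Definition w_star (R : realType) (K M : nat) (nrm : 'rV[R]_K -> R)
    (b : 'I_M.+1 -> 'rV[R]_K) (m : 'I_M.+1) : R :=
  (dual_norm nrm (b m))^-1 / \sum_(l < M.+1) (dual_norm nrm (b l))^-1.

(* Main.v *)
From HB Require Import structures.
Require Import Defs.
From mathcomp Require Import all_boot all_order all_algebra.
From mathcomp Require Import all_classical all_reals all_analysis.
From mathcomp Require Import measurable_realfun.
From mathcomp Require Import ring lra.

(** Fix a decision [x], put [W = \sum_m 1 / ||b_m||_*] and let [f] be the loss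
at [x] with the weights [w*].  These weights give all the affine pieces of [f]
the same steepness [w*_m ||b_m||_* = 1 / W].  So [f] is [1/W]-Lipschitz for the
given norm ([loss_lipschitz]), and from every point it can be increased at
exactly this rate, by following a direction in which the dual norm of an active
[b_m] is attained ([loss_steep]).

For a function [f] with these two properties, with common constant [l], the
worst-case CVaR over the Wasserstein ball is

  [min_t (t + (1 / (N eps)) \sum_i (f (xi_i) - t)^+) + l theta / eps],

that is, the CVaR of the sample plus a constant, which is the content of
[worst_case_CVaR_le].

- Upper bound ([CVaR_le_sample_objective]).  For a fixed [t], the function
  [(f - t)^+] is [l]-Lipschitz, so transporting the empirical measure at a cost
  of at most [theta] raises its mean by at most [l theta].

- Lower bound ([exists_worst_case]).  All the transport budget is spent on a
  sample where [f] is largest: the fraction [lam = min (1, N eps)] of its atom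
  is moved as far as the budget permits, along a direction of steepest ascent.
  The mass moved does not exceed [eps], so it lies in the tail that CVaR
  averages, and the whole gain [l theta] counts with the factor [1 / eps].  The
  comparison is made for each [t] ([sample_CVaR_objective_split]), and the
  minimum over [t] of the sample objective exists since that objective is
  continuous and coercive for [0 < eps < 1] ([sample_CVaR_objective_min]).

With [l = 1 / W], multiplying the resulting constraint by [W N eps] and putting
[t' = - W t] and [s_i = W (f (xi_i) - t)^+] turns it into the linear system of
[C_JCC] with [kappa = 1] ([C_JCC_sample_CVaR]).  The two programs thus have the
same feasible decisions, hence the same value. *)

Set Implicit Arguments.
Unset Strict Implicit.
Unset Printing Implicit Defensive.

Import Order.TTheory GRing.Theory Num.Theory.
Import numFieldNormedType.Exports.

Local Open Scope classical_set_scope.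
Local Open Scope ring_scope.

(** * Norms on row vectors and their duals *)

Lemma ler_coord_norm (R : realType) (n : nat) (u : 'rV[R]_n) (j : 'I_n) :
  `|u ord0 j| <= `|u|.
Proof.
rewrite [leRHS]/Num.norm /= mx_normrE; apply/bigmax_geP; right => /=.
by exists (ord0, j).
Qed.

Section norm.
Context (R : realType) (n : nat) (nrm : 'rV[R]_n -> R).
Hypothesis nrm_norm : is_norm nrm.

Lemma norm_fun0 : nrm 0 = 0.
Proof.
by rewrite -(scale0r (0 : 'rV_n)) (is_norm_homog nrm_norm) normr0 mul0r.
Qed.

Lemma norm_funN u : nrm (- u) = nrm u.
Proof. by rewrite -scaleN1r (is_norm_homog nrm_norm) normrN1 mul1r. Qed.

Lemma norm_fun_ge0 u : 0 <= nrm u.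
Proof.
have := is_norm_triangle nrm_norm u (- u).
by rewrite subrr norm_fun0 norm_funN -mulr2n pmulrn_lge0.
Qed.

(** Half of the equivalence of norms: expand [u] in the canonical basis. *)
Lemma norm_fun_le_sup : exists2 C, 0 <= C & forall u, nrm u <= C * `|u|.
Proof.
exists (\sum_(j < n) nrm (delta_mx ord0 j)).
  by apply: sumr_ge0 => j _; exact: norm_fun_ge0.
move=> u; rewrite [in leLHS](row_sum_delta u) mulr_suml.
elim/big_rec2: _ => [|j x y _ IH]; first by rewrite norm_fun0.
apply: le_trans (is_norm_triangle nrm_norm _ _) _; apply: lerD => //.
rewrite (is_norm_homog nrm_norm) mulrC ler_wpM2l ?norm_fun_ge0//.
exact: ler_coord_norm.
Qed.

(** The topology of the row vectors comes from the sup norm, which dominates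
[nrm] up to a factor. *)
Lemma lipschitz_norm_continuous (f : 'rV[R]_n -> R) (l : R) :
  0 <= l -> (forall u v, f u - f v <= l * nrm (u - v)) -> continuous f.
Proof.
move=> l0 fl; have [C C0 nrmC] := norm_fun_le_sup.
have fC u v : `|f u - f v| <= (l * C + 1) * `|u - v|.
  have lC w : l * nrm w <= (l * C + 1) * `|w|.
    rewrite mulrDl mul1r -mulrA ler_wpDr//.
    exact: ler_wpM2l.
  rewrite ler_norml lerNl opprB (le_trans (fl u v) (lC _)) andbT.
  by rewrite (le_trans (fl v u))// (le_trans (lC _))// distrC.
have k0 : 0 < l * C + 1 by rewrite ltr_wpDl// mulr_ge0.
move=> u; apply/(@cvgrPdist_lt _ _ _ _ (nbhs_filter u)) => e e0.
apply/nbhs_ballP; exists (e / (l * C + 1)) => /=; first by rewrite divr_gt0.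
move=> v; rewrite -ball_normE /= => uv; apply: le_lt_trans (fC _ _) _.
by rewrite mulrC -ltr_pdivlMr.
Qed.

Lemma norm_fun_continuous : continuous nrm.
Proof.
apply: (@lipschitz_norm_continuous _ 1) => // u v.
rewrite mul1r lerBlDr (le_trans _ (is_norm_triangle nrm_norm _ _))//.
by rewrite subrK.
Qed.

(** The other half of the equivalence of norms: on the compact unit sphere of
the sup norm, the continuous function [nrm] attains a minimum, which is positive
by definiteness. *)
Lemma sup_le_norm_fun : exists2 k, 0 < k & forall u, k * `|u| <= nrm u.
Proof.
pose S := [set u : 'rV[R]_n | `|u| = 1].
have normalize (u : 'rV[R]_n) : u != 0 -> S (`|u|^-1 *: u).
  move=> u0; rewrite /S/= normrZ normrV ?unitfE ?normr_eq0// normr_id.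
  by rewrite mulVf// normr_eq0.
have [S0|S0] := pselect (S !=set0); last first.
  (* An empty sphere means n = 0. *)
  exists 1 => // u; have [->|u0] := eqVneq u 0.
    by rewrite normr0 mulr0 norm_fun0.
  by exfalso; apply: S0; exists (`|u|^-1 *: u); exact: normalize.
have cS : compact S.
  apply: bounded_closed_compact.
    by exists 1; split=> // x x1 y /= ->; exact: ltW.
  have -> : S = (fun u => `|u|) @^-1` [set 1 : R] by [].
  apply: preimage_closed; last exact: closed_eq.
  by move=> u _; exact: norm_continuous.
have [v vS vmin] := EVT_min_rV S0 cS (continuous_subspaceT norm_fun_continuous).
have v0 : v != 0.
  move: vS; rewrite inE /S/= => /eqP; apply: contraTneq => ->.
  by rewrite normr0 eq_sym oner_eq0.
exists (nrm v) => [|u].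
  rewrite lt0r norm_fun_ge0 andbT; apply: contra v0 => /eqP.
  by move=> /(is_norm_definite nrm_norm) ->.
have [->|u0] := eqVneq u 0; first by rewrite normr0 mulr0 norm_fun0.
have /vmin : `|u|^-1 *: u \in S by rewrite inE; exact: normalize.
rewrite (is_norm_homog nrm_norm) normrV ?unitfE ?normr_eq0// normr_id.
by rewrite ler_pdivlMl ?normr_gt0// mulrC.
Qed.

Lemma dotD (b u v : 'rV[R]_n) : dot b (u + v) = dot b u + dot b v.
Proof.
by rewrite /dot -big_split/=; apply: eq_bigr => i _; rewrite mxE mulrDr.
Qed.

Lemma dotZ (b u : 'rV[R]_n) k : dot b (k *: u) = k * dot b u.
Proof.
by rewrite /dot mulr_sumr; apply: eq_bigr => i _; rewrite mxE mulrCA.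
Qed.

Lemma dotN (b u : 'rV[R]_n) : dot b (- u) = - dot b u.
Proof. by rewrite -scaleN1r dotZ mulN1r. Qed.

Lemma dual_norm_has_sup (b : 'rV[R]_n) :
  has_sup [set dot b u | u in [set u | nrm u <= 1]].
Proof.
split; first by exists (dot b 0), 0; rewrite //= norm_fun0.
have [k k0 kn] := sup_le_norm_fun.
exists (\sum_(j < n) `|b ord0 j| * k^-1) => _ [u /= u1 <-].
apply: ler_sum => j _; apply: le_trans (ler_norm _) _; rewrite normrM.
apply: ler_wpM2l => //; apply: le_trans (ler_coord_norm u j) _.
by rewrite -[leRHS]mulr1 ler_pdivlMl// (le_trans (kn u)).
Qed.

Lemma dot_le_dual_norm (b u : 'rV[R]_n) : dot b u <= dual_norm nrm b * nrm u.
Proof.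
have [u0|u0] := eqVneq (nrm u) 0.
  rewrite (is_norm_definite nrm_norm u0) norm_fun0 mulr0.
  by rewrite -(scale0r (0 : 'rV_n)) dotZ mul0r.
have nu0 : 0 < nrm u by rewrite lt0r u0 norm_fun_ge0.
rewrite -ler_pdivrMr// mulrC -dotZ; apply: sup_upper_bound.
  exact: dual_norm_has_sup.
exists ((nrm u)^-1 *: u) => //=.
by rewrite (is_norm_homog nrm_norm) gtr0_norm ?invr_gt0// mulVf.
Qed.

Lemma dual_norm_gt0 (b : 'rV[R]_n) : b != 0 -> 0 < dual_norm nrm b.
Proof.
move=> b0; rewrite ltNge; apply: contra b0 => db.
have bb : dot b b <= 0.
  by rewrite (le_trans (dot_le_dual_norm _ _))// mulr_le0_ge0// norm_fun_ge0.
have /eqP : dot b b = 0.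
  apply/eqP; rewrite eq_le bb/=; apply: sumr_ge0 => j _.
  by rewrite -expr2 sqr_ge0.
rewrite /dot psumr_eq0; last by move=> j _; rewrite -expr2 sqr_ge0.
move=> /allP bj0; apply/eqP/rowP => j; rewrite mxE.
have := bj0 j (mem_index_enum _); rewrite mulf_eq0 orbb.
by move=> /eqP.
Qed.

(** The unit ball of [nrm] is compact by the equivalence of norms. *)
Lemma dual_norm_attained (b : 'rV[R]_n) :
  exists2 u, nrm u <= 1 & dot b u = dual_norm nrm b.
Proof.
pose B := [set u | nrm u <= 1].
have B0 : B !=set0 by exists 0; rewrite /B/= norm_fun0.
have cB : compact B.
  apply: bounded_closed_compact.
    have [k k0 kn] := sup_le_norm_fun.
    exists k^-1; split=> [|x kx u u1]; first exact: num_real.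
    apply: le_trans (ltW kx); rewrite -[leRHS]mulr1 ler_pdivlMl//.
    exact: le_trans (kn u) u1.
  have -> : B = nrm @^-1` [set x | x <= 1] by [].
  apply: preimage_closed; last exact: closed_le.
  by move=> u _; exact: norm_fun_continuous.
have d0 : 0 <= dual_norm nrm b.
  apply: sup_upper_bound; first exact: dual_norm_has_sup.
  by exists 0; rewrite /= ?norm_fun0// -(scale0r (0 : 'rV_n)) dotZ mul0r.
have cb : continuous (dot b).
  apply: (lipschitz_norm_continuous d0) => u v.
  by rewrite -dotN -dotD; exact: dot_le_dual_norm.
have [u uB umax] := EVT_max_rV B0 cB (continuous_subspaceT cb).
exists u; first by move: uB; rewrite inE.
apply/eqP; rewrite eq_le; apply/andP; split.
  apply: sup_upper_bound; first exact: dual_norm_has_sup.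
  by exists u => //; rewrite inE in uB.
apply: ge_sup; first by exists (dot b 0), 0; rewrite //= norm_fun0.
by move=> _ [v v1 <-]; apply: umax; rewrite inE.
Qed.

End norm.

(** * Integrals *)

(** For a nonnegative function that need not be measurable, [\int] is the
supremum of the integrals of the simple functions below it.  This is what lets
the transport cost [nrm (z.1 - z.2)] be handled on the product of two Borel
sigma-algebras without showing that it is measurable there: an upper bound on
its integral is only ever transferred to measurable minorants, and for finitely
supported measures only minorants need be evaluated. *)

Section lower_integral.
Local Open Scope ereal_scope.
Context d (T : measurableType d) (R : realType).
Variable mu : {measure set T -> \bar R}.

Import HBNNSimple.

Lemma ge0_le_integral_nonmeasurable (f g : T -> \bar R) :
  (forall x, 0 <= f x) -> (forall x, f x <= g x) ->
  \int[mu]_x f x <= \int[mu]_x g x.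
Proof.
move=> f0 fg; have g0 x : 0 <= g x := le_trans (f0 x) (fg x).
rewrite !ge0_integralTE//; apply: ereal_sup_le => _ [h hf <-].
by exists h => // x; exact: le_trans (hf x) (fg x).
Qed.

Lemma integral_le_measurable_minorants (f : T -> \bar R) (c : \bar R) :
  (forall x, 0 <= f x) ->
  (forall g : T -> R, measurable_fun setT g -> (forall x, 0 <= g x)%R ->
    (forall x, (g x)%:E <= f x) -> \int[mu]_x (g x)%:E <= c) ->
  \int[mu]_x f x <= c.
Proof.
move=> f0 H; rewrite ge0_integralTE//; apply: ge_ereal_sup => _ [h hf <-].
have := integral_nnsfun mu measurableT h; rewrite patch_setT => <-.
by apply: H => // x; exact: fun_ge0.
Qed.

End lower_integral.

Section finite_support.
Local Open Scope ereal_scope.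
Context d (T : measurableType d) (R : realType) (I : finType).
Variables (q : I -> R) (z : I -> T).
Hypothesis q0 : forall i, (0 <= q i)%R.

(** The property is only about values on measurable sets, so that it applies to
any measure with these atoms, however built. *)
Definition finitely_supported (mu : set T -> \bar R) :=
  forall A, measurable A -> mu A = \sum_i (q i)%:E * \d_(z i) A.

Let atom (i0 : I) (k : nat) : {measure set T -> \bar R} :=
  mscale (NngNum (q0 (nth i0 (enum I) k))) (\d_(z (nth i0 (enum I) k))).

Let sum_enum (i0 : I) (F : I -> \bar R) :
  \sum_(k < #|I|) F (nth i0 (enum I) k) = \sum_i F i.
Proof.
by rewrite -[RHS]big_enum /= (big_nth i0) big_mkord -cardE.
Qed.

Let atomE i0 A : msum (atom i0) #|I| A = \sum_i (q i)%:E * \d_(z i) A.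
Proof. by rewrite -(sum_enum i0). Qed.

Lemma finitely_supported_probability :
  (\sum_i q i = 1)%R -> exists P : probability T R, finitely_supported P.
Proof.
move=> q1; have [i0 _|I0] := pickP (fun _ : I => true); last first.
  by move: q1; rewrite big_pred0// => /esym/eqP; rewrite oner_eq0.
pose mu := msum (atom i0) #|I|.
have muT : mu setT = 1.
  rewrite /mu atomE -[RHS]/(1%R%:E) -q1 -sumEFin; apply: eq_bigr => i _.
  by rewrite diracT mule1.
pose P : probability T R :=
  HB.pack mu (Measure_isProbability.Build _ _ _ mu muT).
by exists P => A _; exact: atomE.
Qed.

Lemma integral_finitely_supported (mu : {measure set T -> \bar R})
    (f : T -> \bar R) :
  finitely_supported mu -> measurable_fun [set: T] f -> (forall x, 0 <= f x) ->
  \int[mu]_x f x = \sum_i (q i)%:E * f (z i).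
Proof.
move=> muE mf f0; have [i0 _|I0] := pickP (fun _ : I => true); last first.
  rewrite big_pred0//.
  rewrite (eq_measure_integral mzero) ?integral_measure_zero// => A mA _.
  by rewrite muE// big_pred0.
transitivity (\int[msum (atom i0) #|I|]_x f x).
  by apply: eq_measure_integral => A mA _; rewrite muE// -(atomE i0).
rewrite ge0_integral_measure_sum// -(sum_enum i0); apply: eq_bigr => k _.
rewrite ge0_integral_mscale//.
by rewrite integral_dirac// diracT mul1e.
Qed.

Lemma integral_finitely_supported_le (mu : {measure set T -> \bar R})
    (f : T -> \bar R) :
  finitely_supported mu -> (forall x, 0 <= f x) ->
  \int[mu]_x f x <= \sum_i (q i)%:E * f (z i).
Proof.
move=> muE f0; apply: integral_le_measurable_minorants => // g mg g0 gf.
rewrite integral_finitely_supported//.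
- by apply: lee_sum => i _; apply: lee_wpmul2l => //; rewrite lee_fin.
- exact/measurable_EFinP.
Qed.

End finite_support.

Lemma continuous_borel_measurable (R : realType) (n : nat)
    (f : 'rV[R]_n -> R) :
  continuous f -> measurable_fun [set: borel_rV R n] (f : borel_rV R n -> R).
Proof.
move=> /continuousP cf; apply: (measurability _ (RGenOpens.measurableE R)).
move=> _ [_ [a [b ->] <-]]; rewrite setTI; apply: sub_sigma_algebra.
exact/cf/interval_open.
Qed.

(** * The CVaR of finitely many equally likely values *)

Definition excess (R : realType) (v t : R) : R := Num.max (v - t) 0.

Definition sample_CVaR_objective (R : realType) (N : nat) (eps : R)
    (v : 'I_N.+1 -> R) (t : R) : R :=
  t + (\sum_i excess (v i) t) / (N.+1%:R * eps).

Section sample_CVaR.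
Context (R : realType) (N : nat) (eps : R) (v : 'I_N.+1 -> R).
Hypothesis eps_in01 : 0 < eps < 1.

Let n_gt0 : 0 < N.+1%:R :> R.
Proof. by rewrite ltr0n. Qed.

Let eps_gt0 : 0 < eps.
Proof. by case/andP: eps_in01. Qed.

Let neps_gt0 : 0 < N.+1%:R * eps.
Proof. exact: mulr_gt0. Qed.

Lemma excess_ge0 (x t : R) : 0 <= excess x t.
Proof. by rewrite le_max lexx orbT. Qed.

Lemma excess_ge (x t : R) : x - t <= excess x t.
Proof. by rewrite le_max lexx. Qed.

Lemma excessE (x t : R) : t <= x -> excess x t = x - t.
Proof. by move=> tx; apply/max_idPl; rewrite subr_ge0. Qed.

Lemma excess_eq0 (x t : R) : x <= t -> excess x t = 0.
Proof. by move=> xt; apply/max_idPr; rewrite subr_le0. Qed.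

Lemma sample_CVaR_objective_above t :
  (forall i, v i <= t) -> sample_CVaR_objective eps v t = t.
Proof.
move=> vt; rewrite /sample_CVaR_objective big1 ?mul0r ?addr0// => i _.
exact/excess_eq0.
Qed.

Lemma sample_CVaR_objective_below t : (forall i, t <= v i) ->
  sample_CVaR_objective eps v t =
  (\sum_i v i) / (N.+1%:R * eps) - t * (eps^-1 - 1).
Proof.
move=> tv; rewrite /sample_CVaR_objective.
under eq_bigr do rewrite excessE//.
rewrite sumrB sumr_const card_ord -[t *+ _]mulr_natl.
field; rewrite ?gt_eqF//.
Qed.

Lemma sample_CVaR_objective_continuous :
  continuous (sample_CVaR_objective eps v).
Proof.
have cs (r : seq 'I_N.+1) : continuous (fun t => \sum_(i <- r) excess (v i) t).
  elim: r => [|i r IH] t.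
    rewrite (_ : (fun _ => _) = cst 0); first exact: cvg_cst.
    by apply/funext => s; rewrite big_nil.
  rewrite (_ : (fun _ => _) =
      (fun s => excess (v i) s + \sum_(j <- r) excess (v j) s)); last first.
    by apply/funext => s; rewrite big_cons.
  apply: cvgD; last exact: IH.
  apply: (@continuous_max R R (fun s => v i - s) (cst 0)); last exact: cvg_cst.
  by apply: cvgB; [exact: cvg_cst|exact: cvg_id].
move=> t; apply: cvgD; first exact: cvg_id.
by apply: cvgMl; exact: cs.
Qed.

(** Beyond a bound on the [|v i|] the objective is affine, with slope [1] on the
right and [1 - 1 / eps < 0] on the left, so that a minimum over a segment is a
global minimum. *)
Lemma sample_CVaR_objective_min : exists t0, forall t,
  sample_CVaR_objective eps v t0 <= sample_CVaR_objective eps v t.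
Proof.
pose B := \sum_i `|v i|.
have vB i : `|v i| <= B.
  by rewrite /B (bigD1 i)//= lerDl sumr_ge0.
have B0 : 0 <= B by rewrite sumr_ge0.
have NBB : - B <= B by rewrite (le_trans _ B0)// oppr_le0.
have [t0 _ t0min] := EVT_min NBB
  (continuous_subspaceT sample_CVaR_objective_continuous).
exists t0 => t.
have [tB|Bt] := leP t B; last first.
  apply: le_trans (t0min B _) _; first by rewrite in_itv/= lexx NBB.
  rewrite !sample_CVaR_objective_above//; first exact: ltW.
    by move=> i; rewrite (le_trans (ler_norm _))// (le_trans (vB i))// ltW.
  by move=> i; rewrite (le_trans (ler_norm _)).
have [Bt|tNB] := leP (- B) t; first by apply: t0min; rewrite in_itv/= Bt.
apply: le_trans (t0min (- B) _) _; first by rewrite in_itv/= lexx NBB.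
have Bv i : - B <= v i.
  by have := vB i; rewrite ler_norml => /andP[].
rewrite !sample_CVaR_objective_below//; last first.
  by move=> i; rewrite (le_trans (ltW tNB)).
rewrite lerD2l lerN2 ler_wpM2r ?ltW// subr_gt0 invf_gt1//.
by case/andP: eps_in01.
Qed.

(** The right-hand side is the objective after the fraction [lam] of the atom at
the largest value [v i0] has been moved to [w].  For [t <= v i0] the gain [g] is
fully seen by the excess over [t]; for [t > v i0] the moved objective has slope
[1 - lam / (N eps) >= 0] or [1] in [t], so it is smallest at [s = v i0]. *)
Lemma sample_CVaR_objective_split (i0 : 'I_N.+1) (lam g w t : R) :
  (forall i, v i <= v i0) -> 0 <= lam <= N.+1%:R * eps -> 0 <= g ->
  v i0 + g <= w ->
  exists s, sample_CVaR_objective eps v s + lam / (N.+1%:R * eps) * g <=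
    t + (\sum_i excess (v i) t + lam * (excess w t - excess (v i0) t))
        / (N.+1%:R * eps).
Proof.
move=> vmax /andP[lam0 lamle] g0 gw.
set D := N.+1%:R * eps; pose k := lam / D.
have k0 : 0 <= k by rewrite divr_ge0// ltW.
have k1 : k <= 1 by rewrite ler_pdivrMr// mul1r.
have -> : t + (\sum_i excess (v i) t + lam * (excess w t - excess (v i0) t)) / D
    = sample_CVaR_objective eps v t + k * (excess w t - excess (v i0) t).
  by rewrite /sample_CVaR_objective -/D /k; ring.
have [tv|vt] := leP t (v i0).
  exists t; rewrite lerD2l ler_wpM2l// (excessE tv).
  by have := excess_ge w t; lra.
exists (v i0); rewrite !sample_CVaR_objective_above//; last first.
  by move=> i; rewrite (le_trans (vmax i))// ltW.
rewrite (excess_eq0 (ltW vt)) subr0 -/k.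
have := excess_ge w t; nra.
Qed.

End sample_CVaR.

(** * Worst-case CVaR over a Wasserstein ball *)

Section worst_case_CVaR.
Context (R : realType) (K N : nat) (nrm : 'rV[R]_K -> R).
Context (xi : 'I_N.+1 -> 'rV[R]_K) (eps theta : R).
Context (f : 'rV[R]_K -> R) (l : R).
Hypothesis nrm_norm : is_norm nrm.
Hypothesis eps_in01 : 0 < eps < 1.
Hypothesis theta_ge0 : 0 <= theta.
Hypothesis l_gt0 : 0 < l.
Hypothesis f_lipschitz : forall u v, f u - f v <= l * nrm (u - v).

Let n_gt0 : 0 < N.+1%:R :> R.
Proof. by rewrite ltr0n. Qed.

Let eps_gt0 : 0 < eps.
Proof. by case/andP: eps_in01. Qed.

Let excess_measurable t :
  measurable_fun [set: borel_rV R K] (fun y : borel_rV R K => excess (f y) t).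
Proof.
apply: measurable_maxr; last exact: measurable_cst.
apply: measurable_funB; last exact: measurable_cst.
apply: continuous_borel_measurable.
exact: (lipschitz_norm_continuous nrm_norm (ltW l_gt0)).
Qed.

Let EFin_excess_measurable t : measurable_fun [set: borel_rV R K]
  (fun y : borel_rV R K => (excess (f y) t)%:E).
Proof. by apply/measurable_EFinP; exact: excess_measurable. Qed.

Lemma integral_empirical (h : borel_rV R K -> \bar R) :
  measurable_fun [set: borel_rV R K] h -> (forall y, (0 <= h y)%E) ->
  (\int[empirical xi]_y h y = \sum_i (N.+1%:R^-1)%:E * h (xi i))%E.
Proof.
move=> mh h0; apply: (@integral_finitely_supported _ _ _ _ (fun=> N.+1%:R^-1)
  (fun i => xi i : borel_rV R K)) => // A mA.
rewrite -[LHS]/((N.+1%:R^-1)%:E * \sum_(i < N.+1) \d_(xi i : borel_rV R K) A)%E.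
by rewrite ge0_sume_distrr// => i _; exact: measure_ge0.
Qed.

Lemma empirical_excess t :
  ('E_(empirical xi)[fun y => excess (f y) t])%E =
  ((\sum_i excess (f (xi i)) t) / N.+1%:R)%:E.
Proof.
rewrite unlock integral_empirical//; last first.
  by move=> y; rewrite lee_fin excess_ge0.
rewrite -ge0_sume_distrr; last by move=> i _; rewrite lee_fin excess_ge0.
by rewrite sumEFin -EFinM mulrC.
Qed.

(** With [F = (f - t)^+], the positive part of [F z.1 - F z.2], divided by [l],
is a measurable function below the transport cost; it carries the Lipschitz
bound through the integral. *)
Lemma coupling_excess_le (P1 P2 : probability (borel_rV R K) R) Q t (c : R) :
  coupling P1 P2 Q ->
  ('E_Q[fun z => nrm ((z.1 : 'rV[R]_K) - (z.2 : 'rV[R]_K))] <= c%:E)%E ->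
  ('E_P1[fun y => excess (f y) t] <=
   'E_P2[fun y => excess (f y) t] + (l * c)%:E)%E.
Proof.
move=> QP Qc; rewrite !unlock.
set F := fun y : borel_rV R K => (excess (f y) t)%:E.
have F0 y : (0 <= F y)%E by rewrite lee_fin excess_ge0.
have marg1 : (\int[P1]_y F y = \int[Q]_z F z.1)%E.
  transitivity (\int[pushforward Q fst]_y F y)%E.
    by apply: eq_measure_integral => A mA _; case: (QP A mA).
  rewrite (ge0_integral_pushforward (@measurable_fst _ _ _ _))//.
  exact: EFin_excess_measurable.
have marg2 : (\int[P2]_y F y = \int[Q]_z F z.2)%E.
  transitivity (\int[pushforward Q snd]_y F y)%E.
    by apply: eq_measure_integral => A mA _; case: (QP A mA).
  rewrite (ge0_integral_pushforward (@measurable_snd _ _ _ _))//.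
  exact: EFin_excess_measurable.
rewrite marg1 marg2.
pose D (z : borel_rV R K * borel_rV R K) :=
  l^-1 * Num.max (excess (f z.1) t - excess (f z.2) t) 0.
have D0 z : 0 <= D z.
  by rewrite mulr_ge0 ?le_max ?lexx ?orbT// invr_ge0 ltW.
have mF1 : measurable_fun [set: borel_rV R K * borel_rV R K]
    (fun z => excess (f z.1) t).
  exact: measurableT_comp (excess_measurable t) measurable_fst.
have mF2 : measurable_fun [set: borel_rV R K * borel_rV R K]
    (fun z => excess (f z.2) t).
  exact: measurableT_comp (excess_measurable t) measurable_snd.
have mD : measurable_fun [set: borel_rV R K * borel_rV R K] D.
  apply: measurable_funM; first exact: measurable_cst.
  apply: measurable_maxr; last exact: measurable_cst.
  exact: measurable_funB.
have Dnrm z : D z <= nrm ((z.1 : 'rV[R]_K) - (z.2 : 'rV[R]_K)).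
  have x0 := mulr_ge0 (ltW l_gt0) (norm_fun_ge0 nrm_norm (z.1 - z.2)).
  rewrite ler_pdivrMl// ge_max x0 andbT.
  have := f_lipschitz z.1 z.2; rewrite /excess; move: x0.
  set x := l * _; set p := f z.1; set q := f z.2.
  by case: (leP (p - t) 0); case: (leP (q - t) 0); lra.
apply: (@le_trans _ _ (\int[Q]_z (F z.2 + (l * D z)%:E))%E).
  apply: ge0_le_integral_nonmeasurable => // z.
  rewrite /F -EFinD lee_fin /D mulrA divff ?gt_eqF// mul1r.
  by rewrite -lerBlDl le_max lexx.
rewrite ge0_integralD//; last 3 first.
- exact/measurable_EFinP.
- by move=> z _; rewrite lee_fin mulr_ge0// ltW.
- by apply/measurable_EFinP; apply: measurable_funM.
apply: leeD => //.
under eq_integral do rewrite EFinM.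
rewrite ge0_integralZl//; last 3 first.
- exact/measurable_EFinP.
- by move=> z _; rewrite lee_fin.
- by rewrite lee_fin ltW.
rewrite EFinM lee_pmul2l// ?lte_fin//.
apply: le_trans Qc; rewrite unlock.
by apply: ge0_le_integral_nonmeasurable => // z; rewrite lee_fin.
Qed.

Lemma CVaR_le_sample_objective P t : wasserstein_ball nrm xi theta P ->
  (CVaR P eps f <=
   (sample_CVaR_objective eps (f \o xi) t + l * theta / eps)%:E)%E.
Proof.
move=> PW; apply/lee_addgt0Pr => e e0.
(* The infimum defining the distance need not be attained; an excess [dl] in
   the transport cost raises the bound on CVaR by [l * dl / eps = e]. *)
pose dl := e * eps / l.
have dl0 : 0 < dl by rewrite divr_gt0// mulr_gt0.
have : (wasserstein nrm P (empirical xi) < (theta + dl)%:E)%E.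
  by rewrite (le_lt_trans PW)// lte_fin ltrDl.
move=> /ereal_inf_lt[_ [Q QP <-]] /ltW Qc.
apply: ereal_inf_le; eexists; first by exists t.
have /lee_wpmul2r : (0 <= (eps^-1)%:E)%E by rewrite lee_fin invr_ge0 ltW.
move=> /(_ _ _ (coupling_excess_le t QP Qc)) H.
rewrite (le_trans (leeD2l _ H))//.
rewrite empirical_excess -!EFinD lee_fin.
rewrite /sample_CVaR_objective /dl le_eqVlt; apply/orP; left; apply/eqP.
by field; rewrite ?gt_eqF.
Qed.

Hypothesis f_steep : forall (v : 'rV[R]_K) (r : R), 0 <= r ->
  exists2 u : 'rV[R]_K, nrm (u - v) <= r & f v + l * r <= f u.

(** One distribution serves all [t] at once: the fraction [lam] of the atom at a
worst sample [xi i0] is moved to a point [w] at distance at most [r], at a cost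
of at most [lam * r / N = theta]. *)
Lemma exists_worst_case : exists2 P, wasserstein_ball nrm xi theta P &
  forall t, exists s,
    ((sample_CVaR_objective eps (f \o xi) s + l * theta / eps)%:E <=
     t%:E + 'E_P[fun y => excess (f y) t] * (eps^-1)%:E)%E.
Proof.
have [i0 _ imax] : exists2 i0 : 'I_N.+1, true & forall i, f (xi i) <= f (xi i0).
  have [i0 _ imax] := @arg_maxP _ _ _ (ord0 : 'I_N.+1) xpredT (f \o xi) isT.
  by exists i0 => // i; exact: imax.
pose lam := Num.min 1 (N.+1%:R * eps).
have lam0 : 0 < lam by rewrite lt_min ltr01 mulr_gt0.
have lam1 : lam <= 1 by rewrite ge_min lexx.
have lame : lam <= N.+1%:R * eps by rewrite ge_min lexx orbT.
pose r := N.+1%:R * theta / lam.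
have r0 : 0 <= r by rewrite divr_ge0 ?(ltW lam0)// mulr_ge0.
have [w wr fw] := f_steep (xi i0) r0.
(* Each sample carries two atoms, indexed by a boolean: the part that moves to
   [w] and the part that stays. *)
pose lami i : R := if i == i0 then lam else 0.
pose q (ib : 'I_N.+1 * bool) : R :=
  (if ib.2 then lami ib.1 else 1 - lami ib.1) / N.+1%:R.
pose z (ib : 'I_N.+1 * bool) : borel_rV R K := if ib.2 then w else xi ib.1.
pose zz (ib : 'I_N.+1 * bool) : borel_rV R K * borel_rV R K := (z ib, xi ib.1).
have q0 ib : 0 <= q ib.
  rewrite divr_ge0 ?(ltW n_gt0)// /lami.
  by case: ib => i [] /=; case: ifP; rewrite ?subr_ge0 ?subr0 ?(ltW lam0).
have sumq (F : 'I_N.+1 * bool -> R) : \sum_ib q ib * F ib =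
    (\sum_i F (i, false) + lam * (F (i0, true) - F (i0, false))) / N.+1%:R.
  transitivity (\sum_i \sum_b q (i, b) * F (i, b)).
    by rewrite pair_bigA; apply: eq_bigr => -[].
  under eq_bigr => i _ do rewrite big_bool /= /q /=.
  transitivity (\sum_i
      (F (i, false) + lami i * (F (i, true) - F (i, false))) / N.+1%:R).
    by apply: eq_bigr => i _; ring.
  rewrite -mulr_suml big_split/= (bigD1 i0 (F := fun i => lami i * _))//=.
  rewrite {1}/lami eqxx [X in _ + (_ + X)]big1 ?addr0// => i /negbTE ii0.
  by rewrite /lami ii0 mul0r.
have sumq1 : \sum_ib q ib = 1.
  under eq_bigr do rewrite -[q _]mulr1.
  rewrite sumq subrr mulr0 addr0 sumr_const card_ord mulfV//.
have [P PE] := finitely_supported_probability z q0 sumq1.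
have [Q QE] := finitely_supported_probability zz q0 sumq1.
exists P.
  apply: (@le_trans _ _
    'E_Q[fun z => nrm ((z.1 : 'rV[R]_K) - (z.2 : 'rV[R]_K))]%E).
    apply: ereal_inf_lbound; exists Q => //= A mA; split.
      rewrite /pushforward QE ?PE//.
      by rewrite -[X in measurable X]setTI; exact: measurable_fst.
    rewrite /pushforward QE; last first.
      by rewrite -[X in measurable X]setTI; exact: measurable_snd.
    transitivity (\sum_ib q ib * \1_A (xi ib.1 : borel_rV R K))%:E.
      by rewrite -sumEFin; apply: eq_bigr => ib _.
    rewrite sumq /= subrr mulr0 addr0 mulrC EFinM -sumEFin.
    by rewrite /empirical.
  rewrite unlock.
  apply: le_trans (integral_finitely_supported_le q0 QE _) _.
    by move=> y; rewrite lee_fin (norm_fun_ge0 nrm_norm).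
  under eq_bigr do rewrite -EFinM.
  rewrite sumEFin sumq /= lee_fin.
  rewrite big1 => [|i _]; last by rewrite subrr (norm_fun0 nrm_norm).
  rewrite subrr (norm_fun0 nrm_norm) subr0 add0r ler_pdivrMr//.
  by rewrite -ler_pdivlMl// mulrC (mulrC theta).
move=> t.
have lam0e : 0 <= lam <= N.+1%:R * eps by rewrite (ltW lam0).
have lr0 : 0 <= l * r by rewrite mulr_ge0// ltW.
have [s hs] := sample_CVaR_objective_split eps_in01 t imax lam0e lr0 fw.
exists s.
rewrite unlock (integral_finitely_supported q0 PE)//; last first.
  by move=> y; rewrite lee_fin excess_ge0.
under eq_bigr do rewrite -EFinM.
rewrite sumEFin sumq /= -EFinM -EFinD lee_fin.
move: hs => /=; rewrite [X in _ <= t + X](_ : _ = (\sum_i excess (f (xi i)) t +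
  lam * (excess (f w) t - excess (f (xi i0)) t)) / N.+1%:R / eps); last first.
  by rewrite invfM mulrA.
apply: le_trans; rewrite lerD2l /r le_eqVlt; apply/orP; left; apply/eqP.
by field; rewrite ?gt_eqF.
Qed.

(** The existence of [t] on the right is stronger than a bound on the infimum
over [t]; it holds since the sample objective attains its minimum. *)
Theorem worst_case_CVaR_le (c : R) :
  (ereal_sup [set CVaR P eps f | P in wasserstein_ball nrm xi theta]
     <= c%:E)%E <->
  exists t, sample_CVaR_objective eps (f \o xi) t + l * theta / eps <= c.
Proof.
split=> [H|[t tc]]; last first.
  apply: ge_ereal_sup => _ [P PW <-].
  by rewrite (le_trans (CVaR_le_sample_objective t PW))// lee_fin.
have [P PW PE] := exists_worst_case.
have [t0 t0min] := sample_CVaR_objective_min (f \o xi) eps_in01.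
exists t0; rewrite -lee_fin; apply: le_trans H.
apply: le_trans (ereal_sup_ubound _); last by exists P.
apply: le_ereal_inf_tmp => _ [t _ <-]; have [s hs] := PE t.
by apply: le_trans hs; rewrite lee_fin lerD2r.
Qed.

End worst_case_CVaR.

(** * The equalizing weights *)

Lemma fmax_ge (R : realType) (M : nat) (f : 'I_M.+1 -> R) m : f m <= fmax f.
Proof. exact: le_bigmax. Qed.

Lemma fmax_le (R : realType) (M : nat) (f : 'I_M.+1 -> R) (y : R) :
  (forall m, f m <= y) -> fmax f <= y.
Proof. by move=> fy; apply/bigmax_leP; split. Qed.

Lemma fmax_attained (R : realType) (M : nat) (f : 'I_M.+1 -> R) :
  exists m, fmax f = f m.
Proof.
rewrite /fmax; elim/big_ind: _ => [|x y [i ->] [j ->]|i _]; last by exists i.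
  by exists ord0.
by case: leP => _; [exists j|exists i].
Qed.

Section equalizing_weights.
Context (R : realType) (L K M : nat) (nrm : 'rV[R]_K -> R).
Context (a : 'I_M.+1 -> 'rV[R]_L) (b : 'I_M.+1 -> 'rV[R]_K) (b0 : 'I_M.+1 -> R).
Hypothesis nrm_norm : is_norm nrm.
Hypothesis b_neq0 : forall m, b m != 0.

Let W := \sum_(m < M.+1) (dual_norm nrm (b m))^-1.

Let dn_gt0 m : 0 < dual_norm nrm (b m).
Proof. exact: dual_norm_gt0. Qed.

Lemma sum_inv_dual_norm_gt0 : 0 < W.
Proof.
rewrite /W big_ord_recl ltr_pwDl ?invr_gt0// sumr_ge0// => m _.
by rewrite invr_ge0 ltW.
Qed.

Let W_gt0 := sum_inv_dual_norm_gt0.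

Lemma w_star_gt0 m : 0 < w_star nrm b m.
Proof. by rewrite divr_gt0 ?invr_gt0. Qed.

(** This is why [w_star] is inversely proportional to the dual norms: all affine
pieces of the loss get the same steepness. *)
Lemma w_star_dual_norm m : w_star nrm b m * dual_norm nrm (b m) = W^-1.
Proof. by rewrite /w_star mulrAC mulVf ?mul1r// gt_eqF. Qed.

Lemma w_star_open_simplex : (1 < M.+1)%N -> open_simplex (w_star nrm b).
Proof.
move=> M1; split=> [m|]; last by rewrite -mulr_suml divff// gt_eqF.
rewrite w_star_gt0 ltr_pdivrMr// mul1r (bigD1 m)//= ltrDl.
have [m' m'm] : exists m', m' != m.
  exists (if m == ord0 then ord_max else ord0).
  have [->|] := eqVneq m ord0; last by rewrite eq_sym.
  by apply/eqP => /(congr1 val)/= M0; rewrite M0 in M1.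
rewrite (bigD1 m')//= ltr_pwDl ?invr_gt0// sumr_ge0// => i _.
by rewrite invr_ge0 ltW.
Qed.

Lemma loss_lipschitz x u v :
  loss a b b0 (w_star nrm b) x u - loss a b b0 (w_star nrm b) x v
    <= W^-1 * nrm (u - v).
Proof.
rewrite lerBlDr; apply: fmax_le => m.
rewrite -lerBlDr (le_trans (lerB (lexx _) (fmax_ge _ m)))//=.
rewrite -mulrBr -(w_star_dual_norm m) -[leRHS]mulrA ler_wpM2l//.
  exact/ltW/w_star_gt0.
rewrite -(norm_funN nrm_norm) [- (u - v)]opprB.
apply: le_trans (dot_le_dual_norm nrm_norm _ _).
by rewrite dotD dotN; lra.
Qed.

(** At [v], move against a vector where the dual norm of an active [b m] is
attained: this piece of the maximum grows at the rate [W^-1], and the others can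
only help. *)
Lemma loss_steep x v (r : R) : 0 <= r ->
  exists2 u, nrm (u - v) <= r &
    loss a b b0 (w_star nrm b) x v + W^-1 * r <= loss a b b0 (w_star nrm b) x u.
Proof.
move=> r0.
have [m mE] := fmax_attained
  (fun m => w_star nrm b m * (dot (a m) x - dot (b m) v - b0 m)).
have [u0 u01 du0] := dual_norm_attained nrm_norm (b m).
exists (v - r *: u0).
  rewrite addrAC subrr sub0r (norm_funN nrm_norm) (is_norm_homog nrm_norm).
  by rewrite ger0_norm// ler_piMr.
apply: le_trans (fmax_ge _ m); rewrite {1}/loss mE /=.
rewrite dotD dotN dotZ du0 -(w_star_dual_norm m) -[X in _ + X]mulrA -mulrDr.
rewrite ler_wpM2l ?(ltW (w_star_gt0 m))//; lra.
Qed.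

(** A change of variables: [t] in the program corresponds to [- t / W] in the
CVaR objective, and for a given [t] the smallest feasible slacks [s] are the
scaled excesses. *)
Lemma C_JCC_sample_CVaR (X : set 'rV[R]_L) (N : nat)
    (xi : 'I_N.+1 -> 'rV[R]_K) (eps theta : R) x :
  0 < eps ->
  (exists s t, C_JCC X a b b0 xi eps theta nrm (fun=> 1) (x, s, t)) <->
  X x /\ exists t, sample_CVaR_objective eps
    (loss a b b0 (w_star nrm b) x \o xi) t + W^-1 * theta / eps <= 0.
Proof.
move=> eps0; set f := loss a b b0 (w_star nrm b) x.
have n0 : 0 < N.+1%:R :> R by rewrite ltr0n.
have slackE m i : 1 * ((dot (b m) (xi i) + b0 m - dot (a m) x)
      / dual_norm nrm (b m)) =
    - (W * (w_star nrm b m * (dot (a m) x - dot (b m) (xi i) - b0 m))).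
  by rewrite /w_star -/W; field; rewrite ?gt_eqF.
have slackP i y : (forall m, y <= 1 * ((dot (b m) (xi i) + b0 m - dot (a m) x)
      / dual_norm nrm (b m))) <-> W * f (xi i) <= - y.
  split=> [H|H m].
    rewrite -ler_pdivlMl//; apply: fmax_le => m /=.
    by rewrite ler_pdivlMl// lerNr -slackE.
  rewrite slackE lerNr (le_trans _ H)// ler_pM2l//.
  exact: (fmax_ge (fun m => w_star nrm b m * _)).
have scale t (S : R) : (t + S / (N.+1%:R * eps) + W^-1 * theta / eps <= 0) =
    (theta * N.+1%:R <= eps * N.+1%:R * (- (W * t)) - W * S).
  rewrite -[LHS](pmulr_rle0 _ (x := W * (N.+1%:R * eps))) ?mulr_gt0//.
  rewrite -[RHS]subr_le0; congr (_ <= 0); field.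
  by rewrite ?gt_eqF.
split=> [[s [t [Xx s0 budget slack]]]|[Xx [t budget]]].
  split=> //; exists (- (t / W)); rewrite scale.
  have -> : - (W * - (t / W)) = t by field; rewrite gt_eqF.
  apply: le_trans budget _; rewrite lerD2l lerN2 mulr_sumr.
  apply: ler_sum => i _.
  rewrite -ler_pdivlMl// ge_max mulr_ge0 ?invr_ge0 ?(ltW W_gt0) ?s0// andbT.
  have /slackP : forall m, t - s ord0 i <= _ := slack^~ i.
  rewrite ler_pdivlMl// /=.
  have -> : W * (f (xi i) - - (t / W)) = W * f (xi i) + t.
    by field; rewrite gt_eqF.
  lra.
exists (\row_i (W * excess (f (xi i)) t)), (- (W * t)).
split=> // [i||m i].
- by rewrite mxE mulr_ge0 ?excess_ge0 ?ltW.
- rewrite scale in budget; rewrite (le_trans budget)// lerD2l lerN2 mulr_sumr.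
  by apply: ler_sum => i _; rewrite mxE.
- rewrite mxE; move: m; apply/slackP.
  have := excess_ge (f (xi i)) t; rewrite -(ler_pM2l W_gt0); lra.
Qed.

End equalizing_weights.

(* There are M.+1 >= 1 constraints and N.+1 >= 1 samples. *)
Theorem proposition11 (R : realType) (L K M N : nat)
    (X : set 'rV[R]_L) (c : 'rV[R]_L)
    (a : 'I_M.+1 -> 'rV[R]_L) (b : 'I_M.+1 -> 'rV[R]_K) (b0 : 'I_M.+1 -> R)
    (xi : 'I_N.+1 -> 'rV[R]_K) (eps theta : R) (nrm : 'rV[R]_K -> R)
    (X_polyhedron : is_polyhedron X) (X_compact : compact X)
    (b_neq0 : forall m, b m != 0)
    (eps_in01 : 0 < eps < 1) (theta_ge0 : 0 <= theta)
    (nrm_norm : is_norm nrm) :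
  ((1 < M.+1)%N -> open_simplex (w_star nrm b)) /\
  Z_CVaR X c a b b0 xi eps theta nrm (w_star nrm b) =
  Z_JCC X c a b b0 xi eps theta nrm (fun=> 1).
Proof.
split; first exact: w_star_open_simplex.
have eps_gt0 : 0 < eps by case/andP: eps_in01.
have l_gt0 : 0 < (\sum_(m < M.+1) (dual_norm nrm (b m))^-1)^-1.
  by rewrite invr_gt0; exact: sum_inv_dual_norm_gt0.
have CVaRP x := worst_case_CVaR_le xi nrm_norm eps_in01 theta_ge0
  l_gt0 (loss_lipschitz a b0 nrm_norm b_neq0 x)
  (loss_steep a b0 nrm_norm b_neq0 x) 0.
have JCCP x := C_JCC_sample_CVaR a b0 nrm_norm b_neq0 X xi theta x eps_gt0.
congr ereal_inf; apply/seteqP.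
split=> [_ [x [Xx /CVaRP Hx] <-]|_ [[[x s] t] zC <-]].
  have [s [t zC]] : exists s t,
    C_JCC X a b b0 xi eps theta nrm (fun=> 1) (x, s, t) by exact/JCCP.
  by exists (x, s, t).
have [Xx /CVaRP Hx] := (JCCP x).1 (ex_intro _ s (ex_intro _ t zC)).
by exists x.
Qed.
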